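(* Let $|r|<1$, $\mathrm{Re}(s)\ge 0$, $\mathrm{Re}(\eta)\ge0$, and let $\tilde Z(r,s,\eta)=(z_1(r,s,\eta),\dots,z_N(r,s,\eta))^T$, with $z_j(r,s,\eta)=\sum_{n=1}^\infty r^n\mathbb{E}(e^{-sW_n-\eta T_n}1_{\{Y_n=j\}})$, satisfy $$\tilde Z(r,s,\eta)=r\,U(s,\eta)\sum_{i=1}^{N}\tilde P^{(i)}\tilde Z(r,\alpha_i(s),\eta)+K(r,s,\eta)$$ in the setting described in the context, where $a$ is the common fixed point of $\alpha_1,\dots,\alpha_N$. Assume that $\mathbb{E}(W_n)<\infty$ for all $n$ and that: (i) $U(s,\eta)$ is analytic in $s$ in a neighborhood of $s=a$, and $\|U(a,\eta)\|_1\le M_U(\eta)$ for some $M_U(\eta)>0$; (ii) $K(r,s,\eta)$ is analytic in $s$ in a neighborhood of $s=a$; (iii) $|r|\,M_U(\eta)<1$. Then $$\tilde Z(r,s,\eta)=\sum_{k=0}^{\infty}\ \sum_{i_1+\cdots+i_N=k}F_{i_1,\dots,i_N}(r,s,\eta)\,K(r,\alpha_{i_1,\dots,i_N}(s),\eta),$$ and the series converges absolutely.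
   Context: $N\ge1$, $E=\{1,\dots,N\}$, $\mathbb{C}_+=\{s\in\mathbb{C}:\mathrm{Re}(s)\ge 0\}$. $(W_n,T_n,Y_n)_{n\ge1}$ is a sequence of random triples with $W_n\ge0$, $T_n\ge0$, $Y_n\in E$. For each $r,\eta$ with $|r|<1$, $\mathrm{Re}(\eta)\ge0$, $U(s,\eta)$ is a known $N\times N$ matrix function and $K(r,s,\eta)$ a known $N\times1$ vector function of $s\in\mathbb{C}_+$, and the functional equation holds for all $s\in\mathbb{C}_+$. $\tilde P^{(i)}=e_ie_i^T$ is the $N\times N$ matrix with $(i,i)$ entry $1$ and all other entries $0$. $\|\cdot\|_1$ is the matrix $1$-norm (maximum absolute column sum). The maps $\alpha_i:\mathbb{C}_+\to\mathbb{C}_+$, $i=1,\dots,N$, satisfy $|\alpha_i(s)-\alpha_i(u)|\le\kappa|s-u|$ for all $s,u\in\mathbb{C}_+$ with a common $\kappa\in(0,1)$, and commute: $\alpha_i(\alpha_j(s))=\alpha_j(\alpha_i(s))$. They have a common fixed point $a$. For non-negative integers $i_1,\dots,i_N$: $\alpha_{i_1,\dots,i_N}(s)=\alpha_1^{i_1}(\alpha_2^{i_2}(\cdots(\alpha_N^{i_N}(s))\cdots))$, where $\alpha_i^{n}$ is the $n$th iterate of $\alpha_i$ and $\alpha_{0,\dots,0}(s)=s$. The matrices $F_{i_1,\dots,i_N}(r,s,\eta)$ are defined recursively by $F_{0,\dots,0}(r,s,\eta)=I$, $F_{i_1,\dots,i_N}(r,s,\eta)=O$ if one of the indices equals $-1$,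 and $$F_{i_1,\dots,i_N}(r,s,\eta)=r\sum_{k=1}^{N}F_{i_1,\dots,i_k-1,\dots,i_N}(r,s,\eta)\,U(\alpha_{i_1,\dots,i_k-1,\dots,i_N}(s),\eta)\,\tilde P^{(k)} .$$ *)

(* Defs.v *)
From HB Require Import structures.
From mathcomp Require Import all_boot all_order all_algebra.
From mathcomp Require Import all_classical all_reals all_analysis.
From mathcomp Require Export complex.

Set Implicit Arguments.
Unset Strict Implicit.
Unset Printing Implicit Defensive.

Import Order.TTheory GRing.Theory Num.Theory.
Import numFieldNormedType.Exports.
Export ComplexField.Normc.

Local Open Scope classical_set_scope.
Local Open Scope ring_scope.
Local Open Scope complex_scope.

(* The usual topology of the complex numbers, i.e. that of the regular module
   over the numeric field R[i].  The library does not attach it to R[i]. *)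
HB.instance Definition _ (R : realType) := NormedModule.copy R[i] R[i]^o.

(* The modulus is the real-valued [normc]; the norm `|z| of R[i], which takes
   values in R[i], is (normc z)%:C. *)

Definition cexp (R : realType) (z : R[i]) : R[i] :=
  Complex (expR (complex.Re z) * cos (complex.Im z))
          (expR (complex.Re z) * sin (complex.Im z)).

(* [fine] loses nothing: for Re s, Re eta >= 0 the integrand of [Zvec] is
   bounded. *)
Definition cexpectation (R : realType) (d : measure_display)
    (T : measurableType d) (P : probability T R) (f : T -> R[i]) : R[i] :=
  Complex (fine 'E_P[fun w => complex.Re (f w)])
          (fine 'E_P[fun w => complex.Im (f w)]).

(* The 0-th terms of the sequences are unused: the summation starts at 1. *)
Definition Zvec (R : realType) (d : measure_display) (Omega : measurableType d)
    (P : probability Omega R) (N : nat) (W T : nat -> Omega -> R)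
    (Y : nat -> Omega -> 'I_N) (r s eta : R[i]) : 'cV[R[i]]_N :=
  \col_j \big[+%R/0]_(1 <= n <oo)
    (r ^+ n * cexpectation P (fun w =>
       cexp (- s * (W n w)%:C - eta * (T n w)%:C) * (Y n w == j)%:R)).

(* [f] is only meaningful on the half-plane Re z >= 0, and [a] may lie on its
   boundary; hence analyticity of [f] near [a] is that of an extension of [f]
   to a full complex neighbourhood of [a].  Over the field R[i], [derivable]
   along 1 is complex differentiability. *)
Definition analytic_near (R : realType) (f : R[i] -> R[i]) (a : R[i]) : Prop :=
  exists g : R[i] -> R[i],
    (\forall z \near a, derivable g z 1) /\
    (\forall z \near a, 0 <= complex.Re z -> g z = f z).

Definition norm1 (R : realType) (m n : nat) (A : 'M[R[i]]_(m, n)) : R :=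
  \big[Num.max/0]_(j < n) \sum_(i < m) normc (A i j).

Section MultiIndices.
Variable N : nat.
Implicit Types (i : {ffun 'I_N -> nat}) (k : 'I_N).

Definition mi0 : {ffun 'I_N -> nat} := [ffun=> 0%N].

Definition midec i k : {ffun 'I_N -> nat} :=
  [ffun l => if l == k then (i l).-1 else i l].

Definition misum i : nat := (\sum_(l < N) i l)%N.

Definition multi_indices (n : nat) : seq {ffun 'I_N -> nat} :=
  [seq i <- [seq [ffun l => nat_of_ord (j l)]
            | j : {ffun 'I_N -> 'I_n.+1}] | misum i == n].

Lemma misum_midec i k : (0 < i k)%N -> misum i = (misum (midec i k)).+1.
Proof.
move=> ik; rewrite /misum (bigD1 k)//= [in RHS](bigD1 k)//= ffunE eqxx.
rewrite -addSn prednK//; congr (_ + _)%N.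
by apply: eq_bigr => l /negPf lk; rewrite ffunE lk.
Qed.

Lemma misum0 : misum mi0 = 0%N.
Proof. by rewrite /misum big1// => l _; rewrite ffunE. Qed.

Lemma misum_eq0 i : (misum i == 0%N) = (i == mi0).
Proof.
apply/idP/eqP => [|->]; last by rewrite misum0.
rewrite sum_nat_eq0 => /forallP H; apply/ffunP => l; rewrite ffunE.
by apply/eqP; have := H l.
Qed.

Lemma mem_multi_indices n i : (i \in multi_indices n) = (misum i == n).
Proof.
rewrite mem_filter; case: eqP => //= si.
have lei l : (i l < n.+1)%N by rewrite ltnS -si /misum (bigD1 l)//= leq_addr.
by apply/mapP; exists [ffun l => Ordinal (lei l)]; rewrite ?mem_enum//;
   apply/ffunP => l; rewrite !ffunE.
Qed.

Lemma multi_indices_uniq n : uniq (multi_indices n).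
Proof.
rewrite filter_uniq// map_inj_uniq ?enum_uniq// => x y /ffunP xy; apply/ffunP => l.
by apply: val_inj; have := xy l; rewrite !ffunE.
Qed.

End MultiIndices.

Section Iterates.
Variables (R : realType) (N : nat).
Local Notation C := R[i].

(* The outermost map is the one of index 0. *)
Definition alpha_comp (alpha : 'I_N -> C -> C) (i : {ffun 'I_N -> nat}) (s : C)
    : C :=
  foldr (fun k z => iter (i k) (alpha k) z) s (enum 'I_N).

Variables (alpha : 'I_N -> C -> C) (U : C -> C -> 'M[C]_N) (r s eta : C).

(* Structural recursion on n, which is always taken to be the sum of the
   indices; terms with an index -1 vanish and are left out of the sum.  See
   [Fmat0] and [Fmat_rec] for the defining equations. *)
Fixpoint Fmat_fuel (n : nat) (i : {ffun 'I_N -> nat}) : 'M[C]_N :=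
  if n is m.+1 then
    r *: \sum_(k < N | (0 < i k)%N)
      (Fmat_fuel m (midec i k) *m U (alpha_comp alpha (midec i k) s) eta
         *m delta_mx k k)
  else 1%:M.

Definition Fmat (i : {ffun 'I_N -> nat}) : 'M[C]_N := Fmat_fuel (misum i) i.

Lemma Fmat0 : Fmat (mi0 N) = 1%:M.
Proof. by rewrite /Fmat misum0. Qed.

Lemma Fmat_rec i : i != mi0 N ->
  Fmat i = r *: \sum_(k < N | (0 < i k)%N)
    (Fmat (midec i k) *m U (alpha_comp alpha (midec i k) s) eta
       *m delta_mx k k).
Proof.
rewrite -misum_eq0 /Fmat; case E: (misum i) => [//|m] _ /=.
congr (_ *: _); apply: eq_bigr => k ik.
by have := misum_midec ik; rewrite E => -[<-].
Qed.

End Iterates.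

(* Main.v *)
(* Iterating the functional equation n times leaves the remainder
   \sum_(|i| = n) F_i Z(alpha_i s).  Right multiplication by P^(k) keeps only the
   k-th column, so |F_i|_1 <= max_k |r| |F_(i - e_k)|_1 |U(alpha_(i - e_k) s)|_1,
   and alpha_i s tends to a as |i| grows.  By continuity of U at a and
   |r| M_U < 1, this gives |F_i|_1 <= C rho^|i| for some rho < 1.  As Z is bounded
   on the half-plane and K along the points alpha_i s, it remains to sum rho^|i|
   over all multi-indices, which gives at most (1 - rho)^(-N). *)
Require Import Defs.
From HB Require Import structures.
From mathcomp Require Import all_boot all_order all_algebra.
From mathcomp Require Import all_classical all_reals all_analysis.
From mathcomp Require Import lra.
Import Order.TTheory GRing.Theory Num.Theory.
Import numFieldNormedType.Exports.
Set Implicit Arguments.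
Unset Strict Implicit.
Unset Printing Implicit Defensive.
Local Open Scope classical_set_scope.
Local Open Scope ring_scope.
Local Open Scope complex_scope.

(** * The modulus and the column-sum norm *)

Section Norms.
Variable R : realType.
Implicit Types (x y : R[i]).

Lemma normc_ge0 x : 0 <= normc x.
Proof. by case: x => u v; exact: sqrtr_ge0. Qed.

Lemma ler_normcD x y : normc (x + y) <= normc x + normc y.
Proof. exact: le_normcD. Qed.

Lemma ler_normc_sum (I : Type) (l : seq I) (p : pred I) (f : I -> R[i]) :
  normc (\sum_(i <- l | p i) f i) <= \sum_(i <- l | p i) normc (f i).
Proof.
elim/big_ind2 : _ => //; first by rewrite normc0.
by move=> x1 y1 x2 y2 h1 h2; rewrite (le_trans (ler_normcD _ _))// lerD.
Qed.

Lemma normcX x n : normc (x ^+ n) = normc x ^+ n.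
Proof. by elim: n => [|n IH]; rewrite ?expr0 ?normc1// !exprS normcM IH. Qed.

Lemma normrc x : `|x| = (normc x)%:C.
Proof. by []. Qed.

Lemma ler_normc_ReIm x : normc x <= `|complex.Re x| + `|complex.Im x|.
Proof.
case: x => u v.
have -> : u +i* v = u%:C + (0 +i* v) by apply/eqP; rewrite eq_complex /= addr0 add0r !eqxx.
apply: le_trans (ler_normcD _ _) _.
by rewrite /= !expr0n/= addr0 add0r !sqrtr_sqr addr0 add0r.
Qed.

Section Norm1.
Variables m n : nat.
Implicit Type A : 'M[R[i]]_(m, n).

Lemma norm1_ge0 A : 0 <= norm1 A.
Proof. rewrite /norm1; elim/big_ind : _ => // [u v u0 _|j _]; first by rewrite le_max u0.
by apply: sumr_ge0 => i _; exact: normc_ge0. Qed.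

Lemma colsum_le_norm1 A j : \sum_(i < m) normc (A i j) <= norm1 A.
Proof. exact: (le_bigmax 0 (fun j => \sum_(i < m) normc (A i j))). Qed.

Lemma norm1_le A (c : R) : 0 <= c ->
  (forall j, \sum_(i < m) normc (A i j) <= c) -> norm1 A <= c.
Proof. by move=> c0 Ac; exact: bigmax_le. Qed.

Lemma normc_le_norm1 A i j : normc (A i j) <= norm1 A.
Proof.
apply: le_trans (colsum_le_norm1 A j).
by rewrite (bigD1 i)//= lerDl sumr_ge0// => *; exact: normc_ge0.
Qed.

Lemma norm10 : norm1 (0 : 'M[R[i]]_(m, n)) = 0.
Proof.
apply/le_anti; rewrite norm1_ge0 andbT norm1_le// => j.
by rewrite big1// => i _; rewrite mxE normc0.
Qed.

Lemma ler_norm1D A B : norm1 (A + B) <= norm1 A + norm1 B.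
Proof.
apply: norm1_le => [|j]; first by rewrite addr_ge0 ?norm1_ge0.
apply: le_trans (lerD (colsum_le_norm1 A j) (colsum_le_norm1 B j)).
by rewrite -big_split ler_sum// => i _; rewrite mxE ler_normcD.
Qed.

Lemma ler_norm1_sum (I : Type) (l : seq I) (f : I -> 'M[R[i]]_(m, n)) :
  norm1 (\sum_(i <- l) f i) <= \sum_(i <- l) norm1 (f i).
Proof.
elim/big_ind2 : _ => //; first by rewrite norm10.
by move=> x1 y1 x2 y2 h1 h2; rewrite (le_trans (ler_norm1D _ _))// lerD.
Qed.

End Norm1.

Lemma colsum_mulmx_le m n p (A : 'M[R[i]]_(m, n)) (B : 'M[R[i]]_(n, p)) k :
  \sum_(i < m) normc ((A *m B) i k) <= norm1 A * \sum_(j < n) normc (B j k).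
Proof.
apply: (@le_trans _ _ (\sum_(i < m) \sum_(j < n) normc (A i j) * normc (B j k))).
  apply: ler_sum => i _; rewrite mxE (le_trans (ler_normc_sum _ _ _))//.
  by apply: ler_sum => j _; rewrite normcM.
rewrite exchange_big mulr_sumr ler_sum//= => j _.
by rewrite -mulr_suml ler_wpM2r ?normc_ge0 ?colsum_le_norm1.
Qed.

Lemma ler_norm1M m n p (A : 'M[R[i]]_(m, n)) (B : 'M[R[i]]_(n, p)) :
  norm1 (A *m B) <= norm1 A * norm1 B.
Proof.
apply: norm1_le => [|k]; first by rewrite mulr_ge0 ?norm1_ge0.
apply: le_trans (colsum_mulmx_le _ _ _) _.
by rewrite ler_wpM2l ?norm1_ge0 ?colsum_le_norm1.
Qed.

(* The topology of the matrix space is entrywise, so norm1 controls it. *)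
Lemma cvg_norm1 (m n : nat) (u : nat -> 'M[R[i]]_(m, n)) (A : 'M[R[i]]_(m, n)) :
  norm1 (A - u k) @[k --> \oo] --> (0 : R) -> u @ \oo --> A.
Proof.
move=> uA; apply/cvg_ballP => e e0.
have /eqP eE : complex.Im e == 0 by move: e0; rewrite ltcE => /andP[].
have re0 : 0 < complex.Re e by move: e0; rewrite ltcE => /andP[].
move/cvgrPdist_lt : uA => /(_ _ re0).
apply: filterS => k; rewrite sub0r normrN ger0_norm ?norm1_ge0// => ule.
split => // i j; rewrite -ball_normE /ball_/= normrc.
rewrite [e]complexE eE mulr0 addr0 ltcR (le_lt_trans _ ule)//.
by have := normc_le_norm1 (A - u k) i j; rewrite !mxE.
Qed.

End Norms.

(** * Sums over multi-indices *)

Section MultiIndexSums.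
Variable N : nat.
Implicit Types (i : {ffun 'I_N -> nat}) (k : 'I_N).

Definition miinc i k : {ffun 'I_N -> nat} :=
  [ffun l => if l == k then (i l).+1 else i l].

Lemma miincK i k : midec (miinc i k) k = i.
Proof. by apply/ffunP => l; rewrite !ffunE; case: eqP. Qed.

Lemma midecK i k : (0 < i k)%N -> miinc (midec i k) k = i.
Proof.
by move=> ik; apply/ffunP => l; rewrite !ffunE; case: eqP => // ->; rewrite prednK.
Qed.

Lemma misum_miinc i k : misum (miinc i k) = (misum i).+1.
Proof. by rewrite (@misum_midec _ _ k) ?miincK// ffunE eqxx. Qed.

(** Decrementing entry [k] is a bijection between the two index sets, with inverse [miinc]. It turns
    the backward recursion for [Fmat] into a forward step from weight [n] to [n.+1]. *)
Lemma sum_multi_indices_midec (V : nmodType) (n : nat) k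
    (G : {ffun 'I_N -> nat} -> V) :
  \sum_(i <- multi_indices N n.+1 | (0 < i k)%N) G (midec i k) =
  \sum_(i <- multi_indices N n) G i.
Proof.
rewrite -big_filter -(big_map (fun i => midec i k) xpredT).
apply/perm_big/uniq_perm; last 2 first.
- exact: multi_indices_uniq.
- move=> i; rewrite mem_multi_indices; apply/mapP/eqP => [[j]|<-].
    rewrite mem_filter mem_multi_indices => /andP[jk /eqP js] ->.
    by apply/succn_inj; rewrite -js -misum_midec.
  exists (miinc i k); last by rewrite miincK.
  by rewrite mem_filter mem_multi_indices misum_miinc eqxx ffunE eqxx.
rewrite map_inj_in_uniq => [|i j].
  by apply: filter_uniq; exact: multi_indices_uniq.
rewrite !mem_filter => /andP[ik _] /andP[jk _] ij.
by rewrite -(midecK ik) ij midecK.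
Qed.

Lemma sum_multi_indices0 (V : nmodType) (G : {ffun 'I_N -> nat} -> V) :
  \sum_(i <- multi_indices N 0) G i = G (mi0 N).
Proof.
rewrite (perm_big [:: mi0 N]) ?big_seq1//.
apply: uniq_perm => [||i]; rewrite ?multi_indices_uniq//.
by rewrite mem_multi_indices misum_eq0 inE.
Qed.

(* Every multi-index of weight less than n lies in the box {0, ..., n - 1}^N,
   over which the sum of rho ^ |i| factors. *)
Lemma sum_expr_misum_le (R : realType) (rho : R) (n : nat) :
  0 <= rho -> rho < 1 ->
  \sum_(0 <= k < n) \sum_(i <- multi_indices N k) rho ^+ misum i <=
    (1 - rho)^-1 ^+ N.
Proof.
move=> rho0 rho1; case: n => [|n].
  by rewrite big_geq// exprn_ge0// invr_ge0 subr_ge0 ltW.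
pose L := [seq [ffun l => nat_of_ord (j l)] | j : {ffun 'I_N -> 'I_n.+1}].
have uL : uniq L.
  rewrite map_inj_uniq ?enum_uniq// => x y /ffunP xy; apply/ffunP => l.
  by apply: val_inj; have := xy l; rewrite !ffunE.
have inL i : (misum i <= n)%N -> i \in L.
  move=> si.
  have lei l : (i l < n.+1)%N.
    by rewrite ltnS (leq_trans _ si)// /misum (bigD1 l)//= leq_addr.
  by apply/mapP; exists [ffun l => Ordinal (lei l)]; rewrite ?mem_enum//;
    apply/ffunP => l; rewrite !ffunE.
have -> : \sum_(0 <= k < n.+1) \sum_(i <- multi_indices N k) rho ^+ misum i =
    \sum_(0 <= k < n.+1) \sum_(i <- L | misum i == k) rho ^+ misum i.
  apply: eq_big_nat => k /andP[_ kn]; rewrite -[RHS]big_filter.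
  apply/perm_big/uniq_perm; rewrite ?multi_indices_uniq ?filter_uniq// => i.
  rewrite mem_multi_indices mem_filter; case: eqP => //= ik.
  by rewrite inL// ik.
(* After the exchange, each index of the box is counted once if its weight is at most [n], and not
   at all otherwise. *)
rewrite (exchange_big_dep xpredT)//=.
apply: (@le_trans _ _ (\sum_(i <- L) rho ^+ misum i)).
  apply: ler_sum => i _.
  rewrite (eq_bigl (fun k : nat => k == misum i)); last by move=> k; rewrite eq_sym.
  rewrite big_nat_cond; case: (leqP (misum i) n) => [in_|ni].
    rewrite -big_nat_cond big_mkord (bigD1 (Ordinal (in_ : misum i < n.+1)%N))//=.
    rewrite big1 ?addr0// => j /andP[/eqP ji] /negP[].
    by apply/eqP/val_inj.
  rewrite big1 ?exprn_ge0// => k /andP[/andP[_ kn] /eqP ki].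
  by move: ni; rewrite -ki ltnNge -ltnS kn.
rewrite big_image/=.
rewrite (eq_bigr (fun j : {ffun 'I_N -> 'I_n.+1} => \prod_(l < N) rho ^+ j l)); last first.
  by move=> j _; rewrite /misum expr_sum; apply: eq_bigr => l _; rewrite ffunE.
(* Distributivity gives the [N]-th power of one finite geometric sum, which is at most
   [(1 - rho)^-1]. *)
rewrite -(bigA_distr_bigA (fun _ (m : 'I_n.+1) => rho ^+ m))/=.
rewrite prodr_const card_ord; apply: lerXn2r.
- by rewrite nnegrE; apply: sumr_ge0 => m _; exact: exprn_ge0.
- by rewrite nnegrE invr_ge0 subr_ge0 ltW.
rewrite -[leRHS]mul1r ler_pdivlMr ?subr_gt0// mulrC -opprB mulNr -subrX1 opprB.
by rewrite lerBlDr lerDl exprn_ge0.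
Qed.

(** Only finitely many multi-indices have weight below [n0], and the sum of [f] over them dominates
    each of these values. *)
Lemma multi_index_bounded (R : realType) (f : {ffun 'I_N -> nat} -> R)
    (n0 : nat) (c : R) :
  (forall i, 0 <= f i) -> (forall i, (n0 <= misum i)%N -> f i <= c) ->
  exists2 b, 0 <= b & forall i, f i <= b.
Proof.
move=> f0 fc.
pose S := \sum_(k < n0) \sum_(i <- multi_indices N k) f i.
have S0 : 0 <= S by do 2 (apply: sumr_ge0 => ? _).
exists (S + Num.max 0 c); first by rewrite addr_ge0// le_max lexx.
move=> i; case: (leqP n0 (misum i)) => [/fc ic|in0].
  by rewrite (le_trans ic)// ler_wpDl// le_max lexx orbT.
rewrite ler_wpDr ?le_max ?lexx// /S (bigD1 (Ordinal in0))//=.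
rewrite ler_wpDr//; first by do 2 (apply: sumr_ge0 => ? _).
rewrite (bigD1_seq i) ?multi_indices_uniq ?mem_multi_indices//=.
by rewrite lerDl sumr_ge0.
Qed.

End MultiIndexSums.

(** * Orbits under the commuting contractions *)

Section CommutingContractions.
Variables (R : realType) (N : nat) (alpha : 'I_N -> R[i] -> R[i]).
Variables (kappa : R) (a : R[i]).
Hypothesis alpha_Cplus :
  forall i s, 0 <= complex.Re s -> 0 <= complex.Re (alpha i s).
Implicit Types (i : {ffun 'I_N -> nat}) (j k : 'I_N) (s u : R[i]) (l : seq 'I_N).

(** The fold of [alpha_comp] over an arbitrary list, to allow induction on the list. *)
Let afold l i s := foldr (fun k z => iter (i k) (alpha k) z) s l.

Lemma iter_Cplus n k s : 0 <= complex.Re s -> 0 <= complex.Re (iter n (alpha k) s).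
Proof. by move=> s0; elim: n => //= n; exact: alpha_Cplus. Qed.

Let afold_Cplus l i s : 0 <= complex.Re s -> 0 <= complex.Re (afold l i s).
Proof. by move=> s0; elim: l => //= k l; exact: iter_Cplus. Qed.

Lemma alpha_comp_Cplus i s :
  0 <= complex.Re s -> 0 <= complex.Re (alpha_comp alpha i s).
Proof. exact: afold_Cplus. Qed.

(** The outer [alpha k] moves inward past the blocks of the other maps until it joins its own block.
    Commutation holds on the half-plane only, so every intermediate point must be shown to stay
    there. *)
Lemma alpha_comp_miinc i k s :
  (forall j k s, 0 <= complex.Re s ->
    alpha j (alpha k s) = alpha k (alpha j s)) ->
  0 <= complex.Re s ->
  alpha k (alpha_comp alpha i s) = alpha_comp alpha (miinc i k) s.
Proof.
move=> alphaC s0.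
have iterC m j z : 0 <= complex.Re z ->
    alpha k (iter m (alpha j) z) = iter m (alpha j) (alpha k z).
  by move=> z0; elim: m => //= m <-; rewrite alphaC// iter_Cplus.
(* Beyond the block of [k] the rest of the fold does not see the increment, since [k] occurs only
   once. *)
have notin l : k \notin l -> afold l (miinc i k) s = afold l i s.
  elim: l => //= j l IH; rewrite inE negb_or => /andP[kj /IH ->].
  by rewrite ffunE eq_sym (negPf kj).
suff main l : uniq l -> k \in l -> alpha k (afold l i s) = afold l (miinc i k) s.
  by rewrite /alpha_comp main ?enum_uniq ?mem_enum.
elim: l => //= j l IH /andP[jl ul]; rewrite inE.
have [kj _|kj /= kl] := eqVneq k j; last first.
  by rewrite iterC ?afold_Cplus// IH// ffunE eq_sym (negPf kj).
by rewrite -kj in jl *; rewrite ffunE eqxx notin.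
Qed.

(** Each of the [misum i] map applications fixes [a], hence shrinks the distance to [a] by the
    factor [kappa]. *)
Lemma alpha_comp_dist i s : 0 <= kappa ->
  (forall k s u, 0 <= complex.Re s -> 0 <= complex.Re u ->
    normc (alpha k s - alpha k u) <= kappa * normc (s - u)) ->
  0 <= complex.Re a -> (forall k, alpha k a = a) -> 0 <= complex.Re s ->
  normc (alpha_comp alpha i s - a) <= kappa ^+ misum i * normc (s - a).
Proof.
move=> kappa0 contr a0 aa s0.
have iter_dist m k z : 0 <= complex.Re z ->
    normc (iter m (alpha k) z - a) <= kappa ^+ m * normc (z - a).
  move=> z0; elim: m => [|m IH]; first by rewrite expr0 mul1r.
  rewrite iterS -{1}(aa k) exprS -mulrA.
  by rewrite (le_trans (contr _ _ _ _ _))// ?iter_Cplus// ler_wpM2l.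
have -> : misum i = (\sum_(k <- enum 'I_N) i k)%N by rewrite big_enum.
rewrite /alpha_comp; elim: (enum 'I_N) => [|k l IH] /=.
  by rewrite big_nil expr0 mul1r.
rewrite big_cons exprD -mulrA (le_trans (iter_dist _ _ _ _)) ?afold_Cplus//.
by rewrite ler_wpM2l ?exprn_ge0.
Qed.

End CommutingContractions.

(** * The coefficient matrices: iterated equation and geometric bound *)

Section SeriesCoefficients.
Variables (R : realType) (N : nat) (alpha : 'I_N -> R[i] -> R[i]).
Variables (U : R[i] -> R[i] -> 'M[R[i]]_N) (r s eta : R[i]).
Implicit Types i : {ffun 'I_N -> nat}.
Local Notation F := (Fmat alpha U r s eta).
Local Notation orbit i := (alpha_comp alpha i s).

(** Expand [Z] by the functional equation at each orbit point of weight [n]. The contributions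
    landing on a given multi-index of weight [n.+1] add up to its [Fmat] by the recursion. *)
Lemma Fmat_mulmx_step (K Z : R[i] -> 'cV[R[i]]_N) n :
  (forall k s, 0 <= complex.Re s -> 0 <= complex.Re (alpha k s)) ->
  (forall j k s, 0 <= complex.Re s ->
    alpha j (alpha k s) = alpha k (alpha j s)) ->
  (forall u, 0 <= complex.Re u ->
    Z u = r *: (U u eta *m \sum_(k < N) (delta_mx k k *m Z (alpha k u))) + K u) ->
  0 <= complex.Re s ->
  \sum_(i <- multi_indices N n) F i *m Z (orbit i) =
  \sum_(i <- multi_indices N n) F i *m K (orbit i) +
  \sum_(i <- multi_indices N n.+1) F i *m Z (orbit i).
Proof.
move=> alphaP alphaC ZE s0.
(* [G k i] is what [i] passes on to [miinc i k]. *)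
pose G k i := r *: (F i *m U (orbit i) eta *m delta_mx k k
                      *m Z (alpha k (orbit i))).
have -> : \sum_(i <- multi_indices N n.+1) F i *m Z (orbit i) =
    \sum_(i <- multi_indices N n.+1) \sum_(k < N | (0 < i k)%N) G k (midec i k).
  rewrite !big_seq; apply: eq_bigr => i; rewrite mem_multi_indices => /eqP si.
  rewrite Fmat_rec -?misum_eq0 ?si//.
  rewrite -scalemxAl mulmx_suml scaler_sumr; apply: eq_bigr => k ik.
  by rewrite /G (alpha_comp_miinc alphaP _ _ alphaC)// midecK.
rewrite (exchange_big_dep xpredT)//=.
under [X in _ = _ + X]eq_bigr do rewrite sum_multi_indices_midec.
rewrite exchange_big -big_split/=; apply: eq_bigr => i _.
rewrite {1}ZE ?alpha_comp_Cplus// mulmxDr addrC; congr (_ + _).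
rewrite -scalemxAr mulmxA mulmx_sumr scaler_sumr.
by apply: eq_bigr => k _; rewrite /G !mulmxA.
Qed.

Lemma Fmat_iteration (K Z : R[i] -> 'cV[R[i]]_N) n :
  (forall k s, 0 <= complex.Re s -> 0 <= complex.Re (alpha k s)) ->
  (forall j k s, 0 <= complex.Re s ->
    alpha j (alpha k s) = alpha k (alpha j s)) ->
  (forall u, 0 <= complex.Re u ->
    Z u = r *: (U u eta *m \sum_(k < N) (delta_mx k k *m Z (alpha k u))) + K u) ->
  0 <= complex.Re s ->
  Z s = \sum_(0 <= m < n) \sum_(i <- multi_indices N m) F i *m K (orbit i) +
        \sum_(i <- multi_indices N n) F i *m Z (orbit i).
Proof.
move=> alphaP alphaC ZE s0; elim: n => [|n {1}->].
  rewrite big_geq// add0r sum_multi_indices0 Fmat0 mul1mx; congr Z.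
  rewrite /alpha_comp; elim: (enum 'I_N) => //= k l <-.
  by rewrite ffunE.
by rewrite big_nat_recr//= -addrA (Fmat_mulmx_step _ alphaP alphaC ZE s0).
Qed.

(* Right multiplication by delta_mx k k keeps only column k, so the summands
   have disjoint columns and the column norm of the sum is a maximum, not a sum.
   This is what prevents a factor N at each step. *)
Lemma norm1_sum_mul_delta (p : pred 'I_N) (A : 'I_N -> 'M[R[i]]_N) (c : R) :
  0 <= c -> (forall k, p k -> norm1 (A k) <= c) ->
  norm1 (\sum_(k < N | p k) (A k *m delta_mx k k)) <= c.
Proof.
move=> c0 Ac; apply: norm1_le => // j.
have E l : (\sum_(k < N | p k) (A k *m delta_mx k k)) l j = (p j)%:R * A j l j.
  rewrite summxE (eq_bigr (fun k => A k l k * (k == j)%:R)); last first.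
    move=> k _; rewrite mxE (bigD1 k)//= big1 => [|q qk].
      by rewrite mxE eqxx addr0 eq_sym.
    by rewrite mxE (negPf qk) mulr0.
  case pj: (p j); last first.
    rewrite mul0r big1// => k pk; case: eqVneq => [kj|]; last by rewrite mulr0.
    by rewrite kj pj in pk.
  rewrite (bigD1 j)//= eqxx mulr1 mul1r big1 ?addr0// => k /andP[_ kj].
  by rewrite (negPf kj) mulr0.
under eq_bigr do rewrite E.
case pj: (p j); last by rewrite big1// => i _; rewrite mul0r normc0.
under eq_bigr do rewrite mul1r.
by rewrite (le_trans (colsum_le_norm1 _ _))// Ac.
Qed.

Lemma norm1Z m n (x : R[i]) (A : 'M[R[i]]_(m, n)) :
  norm1 (x *: A) <= normc x * norm1 A.
Proof.
apply: norm1_le => [|j]; first by rewrite mulr_ge0 ?norm1_ge0 ?normc_ge0.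
under eq_bigr do rewrite mxE normcM.
by rewrite -mulr_sumr ler_wpM2l ?normc_ge0 ?colsum_le_norm1.
Qed.

(** The constant [c] absorbs the finitely many coefficients of weight at most [n0]; beyond that,
    each step of the recursion costs a factor [rho]. *)
Lemma Fmat_geometric (rho : R) (n0 : nat) : 0 < rho ->
  (forall i, (n0 <= misum i)%N -> normc r * norm1 (U (orbit i) eta) <= rho) ->
  exists2 c, 0 <= c & forall i, norm1 (F i) <= c * rho ^+ misum i.
Proof.
move=> rho0 Urho.
(* The cutoff includes weight [n0]: the step to weight [n.+1] uses [U] at weight [n], so it needs
   [n0 <= n]. *)
pose f i := if (misum i <= n0)%N then norm1 (F i) / rho ^+ misum i else 0.
have [c c0 fc] : exists2 c, 0 <= c & forall i, f i <= c.
  apply: (@multi_index_bounded _ _ _ n0.+1 0) => i; rewrite /f.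
    by case: ifP => // _; rewrite divr_ge0 ?norm1_ge0// exprn_ge0// ltW.
  by rewrite ltnNge => /negPf ->.
exists c => // i; move: {2}(misum i) (erefl (misum i)) => n.
elim: n i => [|n IH] i ni.
  have := fc i; rewrite /f ni leq0n ler_pdivrMr// ?exprn_gt0//.
have [nn0|n0n] := leqP n.+1 n0.
  have := fc i; rewrite /f ni nn0 ler_pdivrMr// ?exprn_gt0//.
rewrite Fmat_rec -?misum_eq0 ?ni//.
apply: le_trans (norm1Z _ _) _.
have [->|r0] := eqVneq r 0.
  by rewrite normc0 mul0r mulr_ge0// exprn_ge0// ltW.
have nr0 : 0 < normc r.
  by rewrite lt_neqAle normc_ge0 andbT eq_sym; apply: contraNneq r0 => /eq0_normc ->.
(* Dividing by the modulus of [r], nonzero here, isolates the sum over columns. *)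
rewrite mulrC -ler_pdivlMr//.
apply: norm1_sum_mul_delta => [|k ik].
  by rewrite divr_ge0 ?normc_ge0// mulr_ge0// exprn_ge0// ltW.
have nk : misum (midec i k) = n by apply/succn_inj; rewrite -ni -misum_midec.
rewrite ler_pdivlMr// (le_trans (ler_wpM2r (normc_ge0 _) (ler_norm1M _ _)))//.
rewrite -mulrA exprSr (mulrA c) ler_pM ?norm1_ge0 ?mulr_ge0 ?normc_ge0 ?norm1_ge0//.
  by have := IH _ nk; rewrite nk.
by rewrite mulrC Urho// nk.
Qed.

End SeriesCoefficients.

(** * Continuity at the fixed point and along orbits *)

Section Continuity.
Variable R : realType.
Implicit Types (a z : R[i]).

(** The differentiable extension is continuous at [a] and agrees with [f] near [a] on the
    half-plane, including at [a] itself. *)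
Lemma analytic_near_continuous (f : R[i] -> R[i]) a (e : R) :
  analytic_near f a -> 0 <= complex.Re a -> 0 < e ->
  exists2 dl : R, 0 < dl & forall z, 0 <= complex.Re z -> normc (z - a) < dl ->
    normc (f z - f a) < e.
Proof.
move=> [g [dg gf]] a0 e0.
have gfa : g a = f a by exact: (nbhs_singleton gf).
have cg : {for a, continuous g}.
  exact/differentiable_continuous/derivable1_diffP/(nbhs_singleton dg).
have ge : \forall z \near a, `|g a - g z| < e%:C.
  by move/cvgrPdist_lt : cg; apply; rewrite ltcR.
have /nbhs_normP[dl /= dl0 H] : \forall z \near a,
    0 <= complex.Re z -> normc (f z - f a) < e.
  apply: filterS2 ge gf => z ge /[apply] <-.
  by rewrite -gfa -normcN opprB -ltcR.
(* Radii of balls are positive elements of [R[i]], hence real; the real part serves as radius in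
   [R]. *)
have /eqP dlE : complex.Im dl == 0 by move: dl0; rewrite ltcE => /andP[].
exists (complex.Re dl); first by move: dl0; rewrite ltcE => /andP[].
move=> z z0 za; apply: H => //=.
rewrite /ball_/= normrc [dl]complexE dlE mulr0 addr0 ltcR.
by rewrite -normcN opprB.
Qed.

End Continuity.

(** The distance of an orbit point to [a] is bounded in terms of its weight alone, so continuity at
    [a] applies to all multi-indices from some weight on. *)
Lemma analytic_orbit_cvg (R : realType) (N m n : nat)
    (alpha : 'I_N -> R[i] -> R[i]) (kappa : R) (a s : R[i])
    (f : R[i] -> 'M[R[i]]_(m, n)) (e : R) :
  (forall k s, 0 <= complex.Re s -> 0 <= complex.Re (alpha k s)) ->
  0 <= kappa -> kappa < 1 ->
  (forall k s u, 0 <= complex.Re s -> 0 <= complex.Re u ->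
    normc (alpha k s - alpha k u) <= kappa * normc (s - u)) ->
  0 <= complex.Re a -> (forall k, alpha k a = a) -> 0 <= complex.Re s ->
  (forall p q, analytic_near (fun z => f z p q) a) -> 0 < e ->
  exists n0, forall i, (n0 <= misum i)%N ->
    norm1 (f (alpha_comp alpha i s)) <= norm1 (f a) + e.
Proof.
move=> alphaP kappa0 kappa1 contr a0 aa s0 fa e0.
(* Each of the [m] entries of a column gets this share of [e]; [m.+1] avoids a zero denominator. *)
have em0 : 0 < e / m.+1%:R by rewrite divr_gt0.
have orbit_near (dl : R) : 0 < dl ->
    exists n0, forall i, (n0 <= misum i)%N -> normc (alpha_comp alpha i s - a) < dl.
  move=> dl0.
  have nk : `|kappa| < 1 by rewrite ger0_norm.
  have /cvgrPdist_lt/(_ _ dl0)[n0 _ Hn0] := cvg_geometric (normc (s - a)) nk.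
  exists n0 => i /Hn0; rewrite /= sub0r normrN ger0_norm; last first.
    by rewrite mulr_ge0 ?normc_ge0// exprn_ge0.
  apply: le_lt_trans; rewrite mulrC.
  exact: (@alpha_comp_dist _ _ _ kappa).
have entry (pq : 'I_m * 'I_n) : exists n0, forall i, (n0 <= misum i)%N ->
    normc (f (alpha_comp alpha i s) pq.1 pq.2 - f a pq.1 pq.2) < e / m.+1%:R.
  have [dl dl0 H] := analytic_near_continuous (fa pq.1 pq.2) a0 em0.
  have [n0 Hn0] := orbit_near _ dl0.
  by exists n0 => i /Hn0; apply: H; exact: alpha_comp_Cplus.
have [h Hh] := choice entry.
exists (\max_pq h pq) => i hi.
rewrite -[X in norm1 X](subrK (f a)) addrC (le_trans (ler_norm1D _ _))// lerD2l.
apply: norm1_le => [|q]; first exact: ltW.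
apply: (@le_trans _ _ (\sum_(p < m) e / m.+1%:R)).
  apply: ler_sum => p _; rewrite !mxE ltW//; apply: (Hh (p, q)).
  exact: leq_trans (leq_bigmax _) hi.
rewrite sumr_const card_ord -[leLHS]mulr_natl mulrCA ger_pMr// ler_pdivrMr// mul1r.
by rewrite ler_nat.
Qed.

(** * Boundedness of the generating function on the half-plane *)

Section GeneratingFunctionBound.
Context (R : realType) (d : measure_display) (Omega : measurableType d).
Variable P : probability Omega R.

(* No measurability is needed: the integral of a nonnegative function is a
   supremum over the simple functions below it. *)
Lemma ge0_integral_le1 (f : Omega -> \bar R) :
  (forall w, 0 <= f w)%E -> (forall w, f w <= 1)%E -> (\int[P]_w f w <= 1)%E.
Proof.
move=> f0 f1; apply: (@le_trans _ _ (\int[P]_w (cst 1 w))%E); last first.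
  by rewrite integral_cst//= mul1e probability_setT.
rewrite !ge0_integralTE//; apply: ereal_sup_le => _ [h /= hf <-].
by exists h => //= w; exact: le_trans (hf w) (f1 w).
Qed.

(** The integrals of the positive and negative parts both lie in [0, 1], so their difference lies in
    [-1, 1]. *)
Lemma expectation_fine_le1 (X : Omega -> R) :
  (forall w, `|X w| <= 1) -> `|fine 'E_P[X]| <= 1.
Proof.
move=> X1; rewrite unlock integralE.
have bnd (f : Omega -> \bar R) : (forall w, 0 <= f w)%E -> (forall w, f w <= 1)%E ->
    exists2 x : R, (\int[P]_w f w)%E = x%:E & 0 <= x <= 1.
  move=> f0 f1; have I0 : (0 <= \int[P]_w f w)%E by exact: integral_ge0.
  have I1 := ge0_integral_le1 f0 f1.
  case: (\int[P]_w f w)%E I0 I1 => [x||]//; rewrite !lee_fin => x0 x1.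
  by exists x => //; rewrite x0.
have [w|w|A -> /andP[A0 A1]] := bnd (fun w => (EFin \o X)^\+ w)%E.
- exact: funepos_ge0.
- by rewrite funeposE ge_max !lee_fin ler01 andbT (le_trans (ler_norm _)).
have [w|w|B -> /andP[B0 B1]] := bnd (fun w => (EFin \o X)^\- w)%E.
- exact: funeneg_ge0.
- rewrite funenegE ge_max !lee_fin ler01 andbT (le_trans (ler_norm _))//.
  by rewrite normrN.
by rewrite /= ler_norml; apply/andP; split; lra.
Qed.

Lemma normc_cexpectation_le (f : Omega -> R[i]) :
  (forall w, `|complex.Re (f w)| <= 1) -> (forall w, `|complex.Im (f w)| <= 1) ->
  normc (cexpectation P f) <= 2.
Proof.
move=> f1 f2; apply: le_trans (ler_normc_ReIm _) _ => /=.
by rewrite -[2]/(1 + 1 : R) lerD// expectation_fine_le1.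
Qed.

Lemma cexp_ReIm_le1 (z : R[i]) (b : bool) : complex.Re z <= 0 ->
  `|complex.Re (cexp z * b%:R)| <= 1 /\ `|complex.Im (cexp z * b%:R)| <= 1.
Proof.
move=> z0; case: b; last by rewrite mulr0 /= normr0.
rewrite mulr1 /= !normrM ger0_norm ?expR_ge0//.
have e1 : expR (complex.Re z) <= 1 by rewrite -expR0 ler_expR.
by split; rewrite mulr_ile1 ?expR_ge0 ?ler_norml ?cos_geN1 ?cos_le1 ?sin_geN1 ?sin_le1.
Qed.

(** The extra summand covers divergence, where [limn u] is [point]. *)
Lemma limn_normc_le (u : nat -> R[i]) (c : R) :
  (forall n, normc (u n) <= c) -> normc (limn u) <= c + normc (point : R[i]).
Proof.
move=> uc; have c0 : 0 <= c := le_trans (normc_ge0 _) (uc 0%N).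
have [/cvgrPdist_lt ul|/dvgP ->] := pselect (cvgn u); last by rewrite lerDr.
apply: (@le_trans _ _ c); last by rewrite lerDl normc_ge0.
apply/ler_addgt0Pr => e e0.
have [|n _ /(_ n (leqnn _))/=] := ul e%:C; first by rewrite ltcR.
rewrite normrc ltcR => /ltW un.
rewrite -[limn u](subrK (u n)) addrC addrC (le_trans (ler_normcD _ _))//.
by rewrite addrC lerD.
Qed.

(* The limit defining an entry is bounded whether or not it exists, because
   the limit of a divergent sequence is a fixed default point. *)
Lemma Zvec_bounded (N : nat) (W T : nat -> Omega -> R) (Y : nat -> Omega -> 'I_N)
    (r eta : R[i]) :
  (forall n w, (1 <= n)%N -> 0 <= W n w) ->
  (forall n w, (1 <= n)%N -> 0 <= T n w) ->
  normc r < 1 -> 0 <= complex.Re eta ->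
  exists2 c : R, 0 <= c & forall u, 0 <= complex.Re u ->
    norm1 (Zvec P W T Y r u eta) <= c.
Proof.
move=> W0 T0 r1 eta0.
(* The first summand bounds the geometric series with terms [2 * normc r ^+ n], where 2 comes from
   the real and imaginary parts; the second is the default limit. *)
pose c1 : R := 2 / (1 - normc r) + normc (point : R[i]).
have c10 : 0 <= c1.
  by rewrite addr_ge0 ?normc_ge0// divr_ge0// subr_ge0 ltW.
exists (N%:R * c1) => [|u u0]; first by rewrite mulr_ge0.
apply: norm1_le => [|j]; first by rewrite mulr_ge0.
rewrite mulr_natl -[X in _ *+ X]card_ord -sumr_const; apply: ler_sum => i _.
rewrite mxE; apply: limn_normc_le => m.
apply: le_trans (ler_normc_sum _ _ _) _.
apply: (@le_trans _ _ (\sum_(1 <= n < m) 2 * normc r ^+ n)).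
  rewrite !big_nat; apply: ler_sum => n /andP[n1 _].
  rewrite normcM normcX mulrC ler_wpM2r ?exprn_ge0 ?normc_ge0//.
  have Re0 w : complex.Re (- u * (W n w)%:C - eta * (T n w)%:C) <= 0.
    case: u u0 eta eta0 => [u1 u2] /= u0 [v1 v2] /= v0.
    have := mulr_ge0 u0 (W0 n w n1); have := mulr_ge0 v0 (T0 n w n1).
    by rewrite !mulr0 !subr0 mulNr => ? ?; rewrite -opprD oppr_le0 addr_ge0.
  by apply: normc_cexpectation_le => w; have [] := cexp_ReIm_le1 (Y n w == i) (Re0 w).
rewrite -mulr_sumr ler_wpM2l//.
apply: (@le_trans _ _ (\sum_(0 <= n < m) normc r ^+ n)).
  case: m => [|m]; first by rewrite !big_geq.
  by rewrite [leRHS]big_nat_recl// big_add1/= lerDr exprn_ge0// normc_ge0.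
rewrite -[leRHS]mul1r ler_pdivlMr ?subr_gt0// big_mkord mulrC -opprB mulNr.
by rewrite -subrX1 opprB lerBlDr lerDl exprn_ge0 ?normc_ge0.
Qed.

End GeneratingFunctionBound.

(** * The series expansion and its absolute convergence *)

Theorem theorem2 (R : realType) (d : measure_display)
    (Omega : measurableType d) (P : probability Omega R)
    (N : nat) (N_ge1 : (1 <= N)%N)
    (W T : nat -> {RV P >-> R}) (Y : nat -> Omega -> 'I_N)
    (W_ge0 : forall n w, (1 <= n)%N -> 0 <= W n w)
    (T_ge0 : forall n w, (1 <= n)%N -> 0 <= T n w)
    (Y_meas : forall n (j : 'I_N), (1 <= n)%N ->
       measurable (Y n @^-1` [set j]))
    (alpha : 'I_N -> R[i] -> R[i]) (kappa : R) (a : R[i])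
    (alpha_Cplus : forall i s, 0 <= complex.Re s -> 0 <= complex.Re (alpha i s))
    (kappa_gt0 : 0 < kappa) (kappa_lt1 : kappa < 1)
    (alpha_contr : forall i s u, 0 <= complex.Re s -> 0 <= complex.Re u ->
       normc (alpha i s - alpha i u) <= kappa * normc (s - u))
    (alpha_comm : forall i j s, 0 <= complex.Re s ->
       alpha i (alpha j s) = alpha j (alpha i s))
    (a_Cplus : 0 <= complex.Re a) (a_fixed : forall i, alpha i a = a)
    (U : R[i] -> R[i] -> 'M[R[i]]_N)
    (K : R[i] -> R[i] -> R[i] -> 'cV[R[i]]_N)
    (r eta : R[i]) (r_lt1 : normc r < 1) (eta_ge0 : 0 <= complex.Re eta)
    (Z_eq : forall s, 0 <= complex.Re s ->
       Zvec P W T Y r s eta =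
         r *: (U s eta *m
           \sum_(i < N) (delta_mx i i *m Zvec P W T Y r (alpha i s) eta))
         + K r s eta)
    (W_fin : forall n, (1 <= n)%N -> ('E_P[W n] < +oo)%E)
    (M_U : R[i] -> R) (M_U_gt0 : 0 < M_U eta)
    (U_analytic : forall i j, analytic_near (fun s => U s eta i j) a)
    (U_bound : norm1 (U a eta) <= M_U eta)
    (K_analytic : forall i, analytic_near (fun s => K r s eta i 0) a)
    (rM_lt1 : normc r * M_U eta < 1)
    (s : R[i]) (s_ge0 : 0 <= complex.Re s) :
  let term (i : {ffun 'I_N -> nat}) : 'cV[R[i]]_N :=
    Fmat alpha U r s eta i *m K r (alpha_comp alpha i s) eta in
  series (fun k => \sum_(i <- multi_indices N k) term i) @ \oo
    --> Zvec P W T Y r s eta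
  /\ cvgn (series (fun k => \sum_(i <- multi_indices N k) norm1 (term i))).
Proof.
set Z := fun u => Zvec P W T Y r u eta.
set K' := fun u => K r u eta.
move=> term.
have [CZ CZ0 Zb] := Zvec_bounded P Y W_ge0 T_ge0 r_lt1 eta_ge0.
(* Far along the orbit [K'] exceeds its norm at [a] by at most 1; finitely many points remain. *)
have [n1 Kn1] := @analytic_orbit_cvg _ _ _ _ alpha kappa a s K' 1 alpha_Cplus
  (ltW kappa_gt0) kappa_lt1 alpha_contr a_Cplus a_fixed s_ge0
  (fun p q => ltac:(rewrite (ord1 q); exact: K_analytic p)) ltr01.
have [CK CK0 Kb] := multi_index_bounded (fun i => norm1_ge0 _) Kn1.
(* The midpoint of [normc r * M_U eta] and 1 leaves room on both sides: for the variation of [U]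
   near [a], and for convergence. *)
pose rho := (1 + normc r * M_U eta) / 2.
have rM0 : 0 <= normc r * M_U eta by rewrite mulr_ge0 ?normc_ge0// ltW.
have rho0 : 0 < rho by rewrite /rho; lra.
have rho1 : rho < 1 by rewrite /rho; lra.
have rMrho : 0 < rho - normc r * M_U eta by rewrite /rho; lra.
have [n0 Un0] := analytic_orbit_cvg alpha_Cplus (ltW kappa_gt0) kappa_lt1
  alpha_contr a_Cplus a_fixed s_ge0 U_analytic rMrho.
have [CF CF0 Fb] : exists2 c, 0 <= c &
    forall i, norm1 (Fmat alpha U r s eta i) <= c * rho ^+ misum i.
  apply: (Fmat_geometric rho0 (n0 := n0)) => i /Un0 Ui.
  apply: (@le_trans _ _ (normc r * (M_U eta + (rho - normc r * M_U eta)))).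
    by rewrite ler_wpM2l ?normc_ge0// (le_trans Ui)// lerD2r.
  (* As [normc r < 1], multiplying the tolerance by it does not increase it. *)
  rewrite mulrDr -lerBrDl; apply: ler_piMl; exact: ltW.
pose b k := \sum_(i <- multi_indices N k) rho ^+ misum i.
have b0 k : 0 <= b k by apply: sumr_ge0 => i _; rewrite exprn_ge0// ltW.
have cvgb : cvgn (series b).
  apply: nondecreasing_is_cvgn; first exact: nondecreasing_series.
  exists ((1 - rho)^-1 ^+ N) => _ [n _ <-].
  exact: sum_expr_misum_le (ltW rho0) rho1.
(* Applied with [x := Z] for the remainder and with [x := K'] for the series. *)
have bound (c : R) (x : R[i] -> 'cV[R[i]]_N) k : 0 <= c ->
    (forall i, norm1 (x (alpha_comp alpha i s)) <= c) ->
    \sum_(i <- multi_indices N k)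
      norm1 (Fmat alpha U r s eta i *m x (alpha_comp alpha i s)) <= CF * c * b k.
  move=> c0 xc; rewrite mulr_sumr; apply: ler_sum => i _.
  rewrite (le_trans (ler_norm1M _ _))// mulrAC.
  by rewrite ler_pM ?norm1_ge0.
split.
  apply: cvg_norm1.
  (* The error of the partial sum is the remainder of the iteration, squeezed to 0 because [b] is
     the term of a convergent series. *)
  apply: (@squeeze_cvgr _ _ _ _ (cst 0) (fun k => CF * CZ * b k)).
  - near=> k; rewrite /= norm1_ge0/=.
    have -> : Zvec P W T Y r s eta =
        series (fun m => \sum_(i <- multi_indices N m) term i) k +
        \sum_(i <- multi_indices N k)
          Fmat alpha U r s eta i *m Z (alpha_comp alpha i s).
      exact: (Fmat_iteration (K := K') (Z := Z) _ alpha_Cplus alpha_comm Z_eq s_ge0).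
    rewrite addrAC subrr add0r (le_trans (ler_norm1_sum _ _))//.
    by apply: bound => // i; apply: Zb; exact: alpha_comp_Cplus.
  - exact: cvg_cst.
  - rewrite -[X in _ --> X](mulr0 (CF * CZ)).
    by apply: cvgM; [exact: cvg_cst|exact: cvg_series_cvg_0].
apply: (@series_le_cvg _ _ (fun k => CF * CK * b k)) => [k|k|k|].
- by apply: sumr_ge0 => i _; exact: norm1_ge0.
- by rewrite mulr_ge0// mulr_ge0.
- exact: (bound _ K').
- have -> : series (fun k => CF * CK * b k) = (fun n => CF * CK * series b n).
    by apply/funext => n; rewrite /series/= mulr_sumr.
  exact: is_cvgMr.
Unshelve. all: by end_near.
Qed.
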